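(* Let $m$ be a positive even integer and let $A, B\subseteq \mathbb{Z}_{m}$ satisfy $A\cup B=\mathbb{Z}_{m}$ and $|A\cap B|=2$ or $|A\cap B|=m-2$. Then $R_{A}(\overline{n})=R_{B}(\overline{n})$ for all $\overline{n}\in \mathbb{Z}_{m}$ if and only if $B=A+\overline{\frac{m}{2}}$.
   Context: $\mathbb{Z}_m$ denotes the set (group) of residue classes modulo $m$. For $A\subseteq\mathbb{Z}_m$ and $\overline{n}\in\mathbb{Z}_m$, $R_A(\overline{n})$ is the number of ordered pairs $(\overline{a},\overline{a'})\in A\times A$ with $\overline{a}+\overline{a'}=\overline{n}$. For $\overline{c}\in\mathbb{Z}_m$, $A+\overline{c}=\{\overline{a}+\overline{c}:\overline{a}\in A\}$. *)

(* Defs.v *)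
From HB Require Import structures.
From mathcomp Require Import all_boot all_order all_algebra.

Set Implicit Arguments.
Unset Strict Implicit.
Unset Printing Implicit Defensive.

Import GRing.Theory.
Local Open Scope ring_scope.

(* 'Z_m is the ring of residue classes modulo m only when 1 < m. *)

(* Ordered pairs: (a, a') and (a', a) are counted separately. *)
Definition repr_count (m : nat) (A : {set 'Z_m}) (n : 'Z_m) : nat :=
  #|[set p : 'Z_m * 'Z_m in setX A A | p.1 + p.2 == n]|.

Definition translate (m : nat) (A : {set 'Z_m}) (c : 'Z_m) : {set 'Z_m} :=
  [set a + c | a in A].

(* Main.v *)
(* Write d = 1_A - 1_B and let I be the intersection of A and B. Since
   1_A + 1_B = 1 + 1_I, the difference R_A - R_B is the convolution
   d * (1 + 1_I). Summing R_A = R_B over all residues gives |A| = |B|, so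
   d * 1 = 0, and hence both d * 1_I and d * 1_(~I) vanish. One of I and ~I is
   a pair {x, y}, so d (n + (x - y)) = - d n for all n. The set I, which is the
   zero set of d, is thus invariant under translation by t = x - y, and so is
   the pair {x, y}; this forces 2 t = 0, that is t = m / 2. Finally B is the set
   where d <= 0 and A the set where d >= 0, so t carries one onto the other. *)
Require Import Defs.
From mathcomp Require Import all_boot all_order all_algebra.
From mathcomp Require Import ring zify.

Set Implicit Arguments.
Unset Strict Implicit.
Unset Printing Implicit Defensive.

Import GRing.Theory.
Local Open Scope ring_scope.

Definition indic (T : finType) (A : {set T}) x : int := (x \in A)%:R.

Lemma sum_indic (T : finType) (A : {set T}) : \sum_a indic A a = #|A|%:R.
Proof.
rewrite -sum1_card natr_sum [RHS]big_mkcond; apply: eq_bigr => a _.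
by rewrite /indic; case: ifP.
Qed.

Section Convolution.

Variable G : finZmodType.
Implicit Types (A B S : {set G}) (d : G -> int) (n t x y : G).

Definition conv (f g : G -> int) n : int := \sum_a f a * g (n - a).

Lemma conv_comm f g n : conv f g n = conv g f n.
Proof.
rewrite /conv (reindex_inj (@inv_inj _ (fun a => n - a) (subKr n))) /=.
by apply: eq_bigr => a _; rewrite subKr mulrC.
Qed.

Lemma sum_conv f g : \sum_n conv f g n = (\sum_a f a) * (\sum_a g a).
Proof.
rewrite exchange_big mulr_suml; apply: eq_bigr => a _.
by rewrite -mulr_sumr (reindex_inj (addIr a)); under eq_bigr do rewrite addrK.
Qed.

Lemma conv_indic_pair d x y n :
  x != y -> conv d (indic [set x; y]) n = d (n - x) + d (n - y).
Proof.
move=> xy; rewrite conv_comm /conv (bigD1 x) //= (bigD1 y) 1?eq_sym //=.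
rewrite big1 ?addr0 => [|a /andP[/negPf ax /negPf ay]].
  by rewrite /indic !inE !eqxx orbT !mul1r.
by rewrite /indic !inE ax ay mul0r.
Qed.

(** Summing the hypothesis over all residues gives [#|A| ^ 2 = #|B| ^ 2], and cardinalities are
    nonnegative. *)
Lemma conv_sqr_eq_sum_sub A B :
  conv (indic A) (indic A) =1 conv (indic B) (indic B) ->
  \sum_a (indic A a - indic B a) = 0.
Proof.
move=> eqAB; apply/eqP; rewrite sumrB !sum_indic subr_eq0.
have : \sum_n conv (indic A) (indic A) n = \sum_n conv (indic B) (indic B) n.
  by apply: eq_bigr => n _; exact: eqAB.
rewrite !sum_conv !sum_indic; nia.
Qed.

Lemma conv_sqr_eq_conv_setI A B n :
  A :|: B = setT ->
  conv (indic A) (indic A) =1 conv (indic B) (indic B) ->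
  conv (fun a => indic A a - indic B a) (indic (A :&: B)) n = 0.
Proof.
move=> AUB eqAB; have d0 := conv_sqr_eq_sum_sub eqAB.
have indicI a : indic (A :&: B) a = indic A a + indic B a - 1.
  have := in_setT a; rewrite -AUB /indic !inE.
  by case: (a \in A); case: (a \in B).
rewrite /conv.
(* Expansion of (1_A - 1_B) * (1_A + 1_B - 1); the cross terms cancel because convolution is
   commutative. *)
transitivity (conv (indic A) (indic A) n - conv (indic B) (indic B) n
  + (conv (indic A) (indic B) n - conv (indic B) (indic A) n)
  - \sum_a (indic A a - indic B a)).
  rewrite /conv -!sumrB -big_split -sumrB /=; apply: eq_bigr => a _.
  by rewrite indicI; ring.
by rewrite eqAB [conv (indic A) _ n]conv_comm d0 !subrr.
Qed.

Lemma conv_sqr_eq_conv_setCI A B n :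
  A :|: B = setT ->
  conv (indic A) (indic A) =1 conv (indic B) (indic B) ->
  conv (fun a => indic A a - indic B a) (indic (~: (A :&: B))) n = 0.
Proof.
move=> AUB eqAB.
transitivity (\sum_a (indic A a - indic B a)
  - conv (fun a => indic A a - indic B a) (indic (A :&: B)) n).
  rewrite /conv -sumrB; apply: eq_bigr => a _.
  rewrite /indic [in LHS]in_setC; case: (_ \in A :&: B) => /=; ring.
by rewrite conv_sqr_eq_sum_sub // conv_sqr_eq_conv_setI // subrr.
Qed.

(** [S] is whichever of the intersection and its complement is a pair. In a general group [t] is
    only some element of order 2; its value is settled later, in ['Z_m]. *)
Lemma conv_sqr_eq_translate A B S :
  A :|: B = setT -> #|S| = 2%N -> S = A :&: B \/ S = ~: (A :&: B) ->
  conv (indic A) (indic A) =1 conv (indic B) (indic B) ->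
  exists t, [/\ t != 0, t + t = 0 & forall n, (n \in B) = (n + t \in A)].
Proof.
move=> AUB /eqP/cards2P[x [y [xy defS]]] SI eqAB.
set d := fun a => indic A a - indic B a.
have d_anti n : d (n + (x - y)) = - d n.
  (* Evaluating at [n + x] turns the two terms into [d n] and [d (n + (x - y))]. *)
  have dS : conv d (indic S) (n + x) = 0.
    by case: SI => ->; [exact: conv_sqr_eq_conv_setI
                       | exact: conv_sqr_eq_conv_setCI].
  move: dS; rewrite defS conv_indic_pair // addrK -[n + x - y]addrA [LHS]addrC.
  by move/eqP; rewrite addr_eq0 => /eqP.
have AB n : (n \in A) || (n \in B) by rewrite -in_setU AUB inE.
have shiftI n : (n + (x - y) \in A :&: B) = (n \in A :&: B).
  have := d_anti n; have := AB n; have := AB (n + (x - y)).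
  rewrite /d /indic !in_setI; by do 4 case: (_ \in _).
have shiftS n : (n + (x - y) \in S) = (n \in S).
  by case: SI => ->; rewrite ?in_setC shiftI.
exists (x - y); split; first by rewrite subr_eq0.
  (* The shift of [x] stays in the pair and cannot be [x], so it is [y]: [x + (x - y) = y]. *)
  have := shiftS x; rewrite defS !inE eqxx /= => /orP[/eqP|/eqP xxy].
    by move/eqP; rewrite -subr_eq0 addrC addKr subr_eq0 (negPf xy).
  by rewrite addrAC xxy subrr.
move=> n; have := d_anti n; have := AB n; have := AB (n + (x - y)).
by rewrite /d /indic; do 4 case: (_ \in _).
Qed.

End Convolution.

(** For a fixed first entry [a], only the second entry [n - a] can contribute. *)
Lemma repr_count_conv (m : nat) (A : {set 'Z_m}) (n : 'Z_m) :
  (repr_count A n)%:R = conv (indic A) (indic A) n.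
Proof.
transitivity (\sum_a \sum_b
    indic [set p : 'Z_m * 'Z_m in setX A A | p.1 + p.2 == n] (a, b)).
  by rewrite pair_bigA -sum_indic; apply: eq_bigr => -[].
apply: eq_bigr => a _; rewrite (bigD1 (n - a)) //= big1 => [|b bna].
  rewrite addr0 /indic !inE /= subrKC eqxx andbT.
  by case: (a \in A); case: (n - a \in A).
have /negPf abn : a + b != n by rewrite addrC -(inj_eq (addIr (- a))) addrK.
by rewrite /indic !inE /= abn andbF.
Qed.

Lemma repr_count_translate (m : nat) (A : {set 'Z_m}) (c n : 'Z_m) :
  repr_count (translate A c) (n + (c + c)) = repr_count A n.
Proof.
have injc : injective (fun p : 'Z_m * 'Z_m => (p.1 + c, p.2 + c)).
  by move=> [a b] [a' b'] /= /pair_equal_spec[/addIr-> /addIr->].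
rewrite /repr_count -[RHS](card_imset _ injc); apply: eq_card => -[u v].
apply/idP/imsetP => /= [|[[a b]]].
  rewrite !inE /= => /andP[/andP[/imsetP[a Aa ->] /imsetP[b Ab ->]]].
  rewrite addrACA (inj_eq (addIr _)) => abn.
  by exists (a, b); rewrite ?inE /= ?Aa ?Ab.
rewrite !inE /= => /andP[/andP[Aa Ab] abn] /pair_equal_spec[-> ->].
by rewrite !(imset_f (+%R^~ c)) //= addrACA (inj_eq (addIr _)).
Qed.

Lemma Zp_half_double (m : nat) :
  (0 < m)%N -> ~~ odd m -> (m./2)%:R + (m./2)%:R = 0 :> 'Z_m.
Proof.
move=> m_gt0 m_even; rewrite -natrD addnn even_halfK //.
by apply: pchar_Zp; case: m m_gt0 m_even => [|[]].
Qed.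

(** The representative satisfies [0 < t < m], so its double is a multiple of [m] strictly between 0
    and 2m, hence [m] itself. *)
Lemma Zp_order2 (m : nat) (t : 'Z_m) :
  (0 < m)%N -> ~~ odd m -> t != 0 -> t + t = 0 -> t = (m./2)%:R.
Proof.
case: m t => [|[|m]] // t _ m_even t0 /(congr1 val) /= tt0.
have lt_t : (t < m.+2)%N := ltn_ord t.
have t_gt0 : (0 < t)%N by rewrite lt0n.
rewrite -[t in LHS]natr_Zp; congr (_%:R).
have /dvdnP[k] : (m.+2 %| t + t)%N by rewrite /dvdn tt0.
have := even_halfK m_even; rewrite -addnn.
by case: k => [|[|k]]; nia.
Qed.

Theorem theorem1p1 (m : nat) (m_gt0 : (0 < m)%N) (m_even : ~~ odd m)
    (A B : {set 'Z_m}) (AUB : A :|: B = [set: 'Z_m])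
    (AIB : #|A :&: B| = 2%N \/ #|A :&: B| = (m - 2)%N) :
  (forall n : 'Z_m, repr_count A n = repr_count B n) <->
  B = translate A (m./2)%:R.
Proof.
(* This gives ['Z_m] exactly [m] elements and makes the truncated [m - (m - 2)] equal to 2. *)
have m_gt1 : (1 < m)%N by case: m m_gt0 m_even {A B AUB AIB} => [|[]].
have half2 := Zp_half_double m_gt0 m_even.
split=> [eqR|-> n]; last first.
  by rewrite -[in RHS](addr0 n) -half2 repr_count_translate.
have [S cardS SI] : exists2 S : {set 'Z_m},
    #|S| = 2%N & S = A :&: B \/ S = ~: (A :&: B).
  case: AIB => cardI; first by exists (A :&: B); [|left].
  exists (~: (A :&: B)); last by right.
  by rewrite cardsCs setCK cardI card_ord Zp_cast // subKn.
have [n|t [t0 tt0 tB]] := conv_sqr_eq_translate AUB cardS SI.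
  by rewrite -!repr_count_conv eqR.
rewrite -(Zp_order2 m_gt0 m_even t0 tt0); apply/setP => n; rewrite tB.
(* Translation by [t] is an involution, so [n] is the translate of [n + t]. *)
apply/idP/imsetP => [Ant|[a Aa ->]]; last by rewrite -addrA tt0 addr0.
by exists (n + t); rewrite // -addrA tt0 addr0.
Qed.
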